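(* Let $\mathcal S=\{(0,1),(1,0),(-1,-1)\}$ (the reverse Kreweras model). Then the generating function $Q(x,y;t)$ of quadrant walks with steps in $\mathcal S$ is algebraic, i.e. satisfies a non-trivial polynomial equation with coefficients in $\mathbb Q[x,y,t]$.
   Context: $q(i,j;n)$ is the number of $n$-step walks from $(0,0)$ to $(i,j)$ with all steps in $\mathcal S$, staying in the quadrant $\{(a,b):a\ge 0,b\ge 0\}$, and $Q(x,y;t)=\sum_{i,j,n\ge 0}q(i,j;n)x^iy^jt^n\in\mathbb Q[x,y][[t]]$. *)

(* Defs.v *)
(* MathComp; classical logic is used only to give power series decidable
   equality and choice. *)
From HB Require Import structures.
From mathcomp Require Import all_boot all_order all_algebra.
From mathcomp Require Import boolp.

Set Implicit Arguments.
Unset Strict Implicit.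
Unset Printing Implicit Defensive.

Import Order.TTheory GRing.Theory Num.Theory.
Local Open Scope ring_scope.

(* [fps R] is the ring R[[t]]; [fps_coef f n] is the coefficient of t^n. *)
Record fps (R : Type) := Fps { fps_coef : nat -> R }.

Lemma fpsP (R : Type) (f g : fps R) :
  (forall n, fps_coef f n = fps_coef g n) <-> f = g.
Proof.
split=> [|-> //]; case: f g => [f] [g] /= fg.
by congr Fps; apply: functional_extensionality_dep.
Qed.

HB.instance Definition _ (R : Type) := gen_eqMixin (fps R).
HB.instance Definition _ (R : Type) := gen_choiceMixin (fps R).

Section FpsRing.
Variable R : comNzRingType.
Implicit Types f g h : fps R.

Definition fps_zero : fps R := Fps (fun=> 0).
Definition fps_opp f : fps R := Fps (fun n => - fps_coef f n).
Definition fps_add f g : fps R := Fps (fun n => fps_coef f n + fps_coef g n).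
Definition fps_one : fps R := Fps (fun n => (n == 0%N)%:R).
Definition fps_mul f g : fps R :=
  Fps (fun n => \sum_(k < n.+1) fps_coef f k * fps_coef g (n - k)).

Lemma fps_addA : associative fps_add.
Proof. by move=> f g h; apply/fpsP => n /=; rewrite addrA. Qed.

Lemma fps_addC : commutative fps_add.
Proof. by move=> f g; apply/fpsP => n /=; rewrite addrC. Qed.

Lemma fps_add0 : left_id fps_zero fps_add.
Proof. by move=> f; apply/fpsP => n /=; rewrite add0r. Qed.

Lemma fps_addN : left_inverse fps_zero fps_opp fps_add.
Proof. by move=> f; apply/fpsP => n /=; rewrite addNr. Qed.

HB.instance Definition _ :=
  GRing.isZmodule.Build (fps R) fps_addA fps_addC fps_add0 fps_addN.

Definition fps_trunc N f : {poly R} := \poly_(i < N) fps_coef f i.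

Lemma coef_fps_mul_trunc N n f g : (n < N)%N ->
  fps_coef (fps_mul f g) n = (fps_trunc N f * fps_trunc N g)`_n.
Proof.
move=> ltnN; rewrite coefM /=; apply: eq_bigr => k _.
have lekn : (k <= n)%N by rewrite -ltnS.
by rewrite !coef_poly (leq_ltn_trans lekn ltnN)
  (leq_ltn_trans (leq_subr _ _) ltnN).
Qed.

Lemma fps_mulC : commutative fps_mul.
Proof.
move=> f g; apply/fpsP => n.
by rewrite !(coef_fps_mul_trunc _ _ (ltnSn n)) mulrC.
Qed.

Lemma fps_mulA : associative fps_mul.
Proof.
move=> f g h; apply/fpsP => n; set T := fps_trunc n.+1.
have lt_n m : (m <= n)%N -> (m < n.+1)%N by [].
transitivity ((T f * (T g * T h))`_n).
  rewrite coefM; apply: eq_bigr => k _.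
  by rewrite coef_poly ltn_ord (coef_fps_mul_trunc _ _ (lt_n _ (leq_subr k n))).
rewrite mulrA coefM; apply: eq_bigr => k _.
by rewrite coef_poly (lt_n _ (leq_subr k n)) (coef_fps_mul_trunc _ _ (ltn_ord k)).
Qed.

Lemma fps_mul1 : left_id fps_one fps_mul.
Proof.
move=> f; apply/fpsP => n /=.
rewrite big_ord_recl /= mul1r subn0 big1 ?addr0 // => k _.
by rewrite mul0r.
Qed.

Lemma fps_mulDl : left_distributive fps_mul fps_add.
Proof.
move=> f g h; apply/fpsP => n /=; rewrite -big_split /=.
by apply: eq_bigr => k _; rewrite mulrDl.
Qed.

Lemma fps_one_neq0 : fps_one != 0.
Proof.
by apply/eqP => /fpsP /(_ 0%N) /= /eqP; rewrite oner_eq0.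
Qed.

HB.instance Definition _ := GRing.Zmodule_isComNzRing.Build (fps R)
  fps_mulA fps_mulC fps_mul1 fps_mulDl fps_one_neq0.

(* The inclusion of R[t] in R[[t]]. *)
Definition fps_of_poly (p : {poly R}) : fps R := Fps (fun n => p`_n).

Lemma fps_of_poly_zmod : zmod_morphism fps_of_poly.
Proof. by move=> p q; apply/fpsP => n /=; rewrite coefB. Qed.

Lemma fps_of_poly_monoid : monoid_morphism fps_of_poly.
Proof.
split; first by apply/fpsP => n /=; rewrite coef1.
by move=> p q; apply/fpsP => n /=; rewrite coefM.
Qed.

HB.instance Definition _ :=
  GRing.isZmodMorphism.Build {poly R} (fps R) fps_of_poly fps_of_poly_zmod.
HB.instance Definition _ :=
  GRing.isMonoidMorphism.Build {poly R} (fps R) fps_of_poly fps_of_poly_monoid.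

Lemma fps_of_poly_inj : injective fps_of_poly.
Proof. by move=> p q /fpsP pq; apply/polyP => n; apply: pq. Qed.

End FpsRing.

Definition quadrant (P : int * int) : bool := (0 <= P.1) && (0 <= P.2).

(* The sum is taken in the group int * int. *)
Definition endpoint (S : seq (int * int)) (w : seq (seq_sub S)) : int * int :=
  \sum_(s <- w) ssval s.

Definition quadrant_walk (S : seq (int * int)) (n : nat)
    (w : n.-tuple (seq_sub S)) : bool :=
  [forall k : 'I_n.+1, quadrant (endpoint (take k w))].

Definition walk_count (S : seq (int * int)) (i j n : nat) : nat :=
  #|[set w : n.-tuple (seq_sub S) |
      quadrant_walk w && (endpoint w == (i%:Z, j%:Z))]|.

Definition revKreweras : seq (int * int) := [:: (0, 1); (1, 0); (-1, -1)].

(* Q[x,y] is {poly {poly rat}}, with y the outer variable. *)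
Definition var_x : {poly {poly rat}} := 'X%:P.
Definition var_y : {poly {poly rat}} := 'X.

(* The sum over all i, j >= 0 is finite for each n: the coordinates increase by
   at most 1 at each step, so the terms with i > n or j > n vanish; see
   [walk_count_gt] and [coef_revKrewerasGF]. *)
Definition revKrewerasGF : fps {poly {poly rat}} :=
  Fps (fun n => \sum_(i < n.+1) \sum_(j < n.+1)
         (walk_count revKreweras i j n)%:R * var_x ^+ i * var_y ^+ j).

Lemma endpoint_le (w : seq (seq_sub revKreweras)) :
  ((endpoint w).1 <= (size w)%:Z) && ((endpoint w).2 <= (size w)%:Z).
Proof.
rewrite /endpoint; elim: w => [|[s sS] w /andP[IH1 IH2]]; first by rewrite big_nil.
rewrite big_cons /= -[(size w).+1]add1n PoszD.
have /andP[s1 s2] : (s.1 <= 1) && (s.2 <= 1).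
  by move: sS; rewrite !inE => /or3P[] /eqP->.
by rewrite !lerD.
Qed.

Lemma walk_count_gt (i j n : nat) :
  (n < i)%N || (n < j)%N -> walk_count revKreweras i j n = 0%N.
Proof.
move=> ltn; apply/eqP; rewrite cards_eq0; apply/eqP/setP => w; rewrite !inE.
apply/negbTE/negP => /andP[_ /eqP ew]; move: (endpoint_le w).
rewrite ew size_tuple /= !lez_nat => /andP[lei lej].
by move: ltn; rewrite !ltnNge lei lej.
Qed.

Lemma coef_revKrewerasGF (i j n : nat) :
  (fps_coef revKrewerasGF n)`_j`_i = (walk_count revKreweras i j n)%:R.
Proof.
have -> : fps_coef revKrewerasGF n =
    \poly_(j < n.+1) \poly_(i < n.+1) (walk_count revKreweras i j n)%:R.
  rewrite /= exchange_big poly_def; apply: eq_bigr => b _ /=.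
  rewrite poly_def -mul_polyC rmorph_sum mulr_suml; apply: eq_bigr => a _.
  by rewrite -mul_polyC rmorphM /= rmorph_nat rmorphXn /= rmorph_nat.
rewrite coef_poly; case: ltnP => [_|ltj]; last first.
  by rewrite coef0 walk_count_gt // ltj orbT.
by rewrite coef_poly; case: ltnP => // lti; rewrite walk_count_gt // lti.
Qed.

(* Main.v *)
From HB Require Import structures.
Require Import Defs.
From mathcomp Require Import all_boot all_order all_algebra.
From mathcomp Require Import ring.

(** Write [R(x) = Q(x,0;t)] and [K = xy - t(x^2 y + x y^2 + 1)].  Removing the
    last step of a walk gives [K Q = xy - t R(x) - t R(y) + t R(0)], so it is
    enough to show that [R] is algebraic; this is done with Tutte invariants.  On the
    curve [K = 0] one has [I(x) = I(y)] for [I(x) = 1/x + x/t - x^2], and, since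
    [xy] decouples there, [L(x) = -L(y)] for
    [L(x) = t R(x) - t R(0)/2 - x/(2t) + x^2/2 + 1/(2x)].  Hence
    [L^2 - I^2/4 - a I - b] takes the same value at [x] and at [y]; with [a] and
    [b] chosen to make it vanish at [x = 0], it is zero.

    The derivative of [L^2 = I^2/4 + a I + b] vanishes at the critical points
    of [I], i.e. where [x^2 = t (1 + 2 x^3)].  Two of these are power series
    [u] and [u'] in [sqrt t]; there [L'] is not zero, so [L] is, and
    [I^2/4 + a I + b] vanishes at [u] and [u'].  These two linear equations
    express [a] and [b] algebraically in terms of [u u'], hence [R] is
    algebraic.  To avoid fractional exponents, [t] is replaced by the power
    series [u^2 / (1 + 2 u^3)] in [u]. *)

Set Implicit Arguments.
Unset Strict Implicit.
Unset Printing Implicit Defensive.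

Import GRing.Theory.
Local Open Scope ring_scope.

(** * Power series: order, congruence modulo [t^n], fixed points *)

Section FpsTheory.
Variable R : comNzRingType.
Implicit Types f g : fps R.

Definition fps_var : fps R := fps_of_poly 'X.
Definition fps_const : R -> fps R := @fps_of_poly R \o polyC.

HB.instance Definition _ := GRing.RMorphism.on fps_const.

Lemma fps_coefD f g n : fps_coef (f + g) n = fps_coef f n + fps_coef g n.
Proof. by []. Qed.

Lemma fps_coefN f n : fps_coef (- f) n = - fps_coef f n.
Proof. by []. Qed.

Lemma fps_coefM f g n :
  fps_coef (f * g) n = \sum_(k < n.+1) fps_coef f k * fps_coef g (n - k).
Proof. by []. Qed.

Lemma fps_coefM0 f g : fps_coef (f * g) 0 = fps_coef f 0 * fps_coef g 0.
Proof. by rewrite fps_coefM big_ord1. Qed.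

Lemma fps_coef_sum I (r : seq I) (P : pred I) (F : I -> fps R) n :
  fps_coef (\sum_(i <- r | P i) F i) n = \sum_(i <- r | P i) fps_coef (F i) n.
Proof. by elim/big_rec2: _ => //= i y1 y2 _ <-. Qed.

Lemma fps_coef_const a n : fps_coef (fps_const a) n = if n == 0%N then a else 0.
Proof. by rewrite /= coefC. Qed.

Lemma fps_coefCM a f n : fps_coef (fps_const a * f) n = a * fps_coef f n.
Proof.
rewrite fps_coefM big_ord_recl /= coefC subn0 big1 ?addr0 // => k _.
by rewrite coefC mul0r.
Qed.

Lemma fps_coefXnM m f n :
  fps_coef (fps_var ^+ m * f) n = if (n < m)%N then 0 else fps_coef f (n - m).
Proof.
rewrite fps_coefM /fps_var -rmorphXn /=; case: ltnP => [ltnm | lemn].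
  rewrite big1 // => k _; rewrite coefXn.
  by rewrite (ltn_eqF (leq_ltn_trans _ ltnm)) ?mul0r // -ltnS.
rewrite (bigD1 (inord m)) //= inordK // coefXn eqxx mul1r big1 ?addr0 // => k.
by rewrite coefXn -val_eqE /= inordK // => /negPf->; rewrite mul0r.
Qed.

Lemma fps_coefX n : fps_coef fps_var n = (n == 1%N)%:R.
Proof. by rewrite /= coefX. Qed.

Lemma fps_coefXM f n :
  fps_coef (fps_var * f) n = if n is m.+1 then fps_coef f m else 0.
Proof. by rewrite -[fps_var]expr1 fps_coefXnM; case: n => //= n; rewrite subn1. Qed.

Lemma fps_neq0_factor f : f != 0 ->
  exists m, exists2 g, f = fps_var ^+ m * g & fps_coef g 0 != 0.
Proof.
move=> nz_f; have [m fm min_m] : exists2 m, fps_coef f m != 0 &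
    forall k, (k < m)%N -> fps_coef f k = 0.
  have /boolp.existsNP[n /eqP fn] : ~ forall n, fps_coef f n = 0.
    by move=> f0; case/eqP: nz_f; apply/fpsP.
  have ex_n : exists n, fps_coef f n != 0 by exists n.
  case: (ex_minnP ex_n) => m fm min_m; exists m => // k; apply: contraTeq.
  by move/min_m; rewrite leqNgt.
exists m; exists (Fps (fun n => fps_coef f (n + m))) => //.
apply/fpsP => n; rewrite fps_coefXnM; case: ltnP => [/min_m //|lemn].
by rewrite /= subnK.
Qed.

Definition fps_eqm n f g := forall k, (k < n)%N -> fps_coef f k = fps_coef g k.

Lemma fps_eqm_trans n f g h : fps_eqm n f g -> fps_eqm n g h -> fps_eqm n f h.
Proof. by move=> fg gh k ltkn; rewrite fg ?gh. Qed.

Lemma fps_eqmD n f g f' g' :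
  fps_eqm n f f' -> fps_eqm n g g' -> fps_eqm n (f + g) (f' + g').
Proof. by move=> ff gg k ltkn; rewrite !fps_coefD ff ?gg. Qed.

Lemma fps_eqmN n f f' : fps_eqm n f f' -> fps_eqm n (- f) (- f').
Proof. by move=> ff k ltkn; rewrite !fps_coefN ff. Qed.

Lemma fps_eqmM n f g f' g' :
  fps_eqm n f f' -> fps_eqm n g g' -> fps_eqm n (f * g) (f' * g').
Proof.
move=> ff gg k ltkn; rewrite !fps_coefM; apply: eq_bigr => i _.
rewrite ff ?gg //; first exact: leq_ltn_trans (leq_subr _ _) ltkn.
exact: leq_ltn_trans (leq_ord i) ltkn.
Qed.

Lemma fps_eqmXM n f f' :
  fps_eqm n f f' -> fps_eqm n.+1 (fps_var * f) (fps_var * f').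
Proof. by move=> ff [|k] ltkn; rewrite !fps_coefXM ?ff. Qed.

(** Banach iteration from 0 in the t-adic metric: the iterate [s k] is settled modulo [t^k], so the
    limit takes its coefficient n from [s n.+1]. *)
Lemma fps_contraction_fixpoint (F : fps R -> fps R) :
    (forall n f g, fps_eqm n f g -> fps_eqm n.+1 (F f) (F g)) ->
  exists f, F f = f.
Proof.
move=> contrF; pose s k := iter k F 0.
have s_eqm k m : fps_eqm k (s k) (s (k + m)%N).
  by elim: k => // k IHk; apply: contrF.
pose f := Fps (fun n => fps_coef (s n.+1) n); exists f; apply/fpsP => n.
transitivity (fps_coef (s n.+1) n) => //.
apply: contrF (ltnSn n) => k ltkn /=.
by rewrite (s_eqm k.+1 (n - k.+1)%N) ?subnKC.
Qed.

End FpsTheory.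

(** The lowest-order coefficients multiply to a nonzero element of [R]. *)
Lemma fps_mulf_neq0 (R : idomainType) (f g : fps R) :
  f != 0 -> g != 0 -> f * g != 0.
Proof.
move=> /fps_neq0_factor[m [f' -> nz_f]] /fps_neq0_factor[n [g' -> nz_g]].
apply/eqP => /fpsP/(_ (m + n)%N)/eqP; rewrite mulrACA -exprD fps_coefXnM ltnn.
by rewrite subnn fps_coefM0 mulf_eq0 (negPf nz_f) (negPf nz_g).
Qed.

Lemma fps_mulfI (R : idomainType) (f g h : fps R) :
  f != 0 -> f * g = f * h -> g = h.
Proof.
move=> nz_f /eqP; rewrite -subr_eq0 -mulrBr => eq0; apply/eqP.
by rewrite -subr_eq0; apply: contraTT eq0 => /(fps_mulf_neq0 nz_f).
Qed.

Lemma fps_expf_neq0 (R : idomainType) (f : fps R) n : f != 0 -> f ^+ n != 0.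
Proof.
by move=> nz_f; elim: n => [|n IHn]; rewrite ?oner_neq0 // exprS fps_mulf_neq0.
Qed.

(** * Coefficient maps and substitution for the series variable *)

Section FpsMap.
Variables (A B : comNzRingType) (h : {rmorphism A -> B}).

Definition fps_map (f : fps A) : fps B := Fps (fun n => h (fps_coef f n)).

Lemma fps_map_zmod : zmod_morphism fps_map.
Proof. by move=> f g; apply/fpsP => n /=; rewrite rmorphB. Qed.

Lemma fps_map_monoid : monoid_morphism fps_map.
Proof.
split=> [|f g]; apply/fpsP => n /=; first by rewrite rmorph_nat.
by rewrite rmorph_sum; apply: eq_bigr => k _; rewrite rmorphM.
Qed.

HB.instance Definition _ :=
  GRing.isZmodMorphism.Build (fps A) (fps B) fps_map fps_map_zmod.
HB.instance Definition _ :=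
  GRing.isMonoidMorphism.Build (fps A) (fps B) fps_map fps_map_monoid.

Lemma fps_map_of_poly (p : {poly A}) :
  fps_map (fps_of_poly p) = fps_of_poly (map_poly h p).
Proof. by apply/fpsP => n /=; rewrite coef_map. Qed.

Lemma fps_map_var : fps_map (fps_var A) = fps_var B.
Proof. by rewrite fps_map_of_poly map_polyX. Qed.

Lemma fps_map_const a : fps_map (fps_const a) = fps_const (h a).
Proof. by rewrite fps_map_of_poly map_polyC. Qed.

End FpsMap.

Section FpsEval.
Variables (A B : comNzRingType) (h : {rmorphism A -> fps B}) (T1 : fps B).
Local Notation T := (fps_var B * T1).

(* The substitution of [t * T1] for t, with h applied to the coefficients. *)
Definition fps_eval (f : fps A) : fps B :=
  Fps (fun n => fps_coef (\sum_(k < n.+1) h (fps_coef f k) * T ^+ k) n).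

Lemma fps_evalE f n : fps_coef (fps_eval f) n =
  fps_coef (\sum_(k < n.+1) h (fps_coef f k) * T ^+ k) n.
Proof. by []. Qed.

(** [T ^+ k] is divisible by the k-th power of the series variable, so the terms with k at least N
    do not reach the coefficients below N. *)
Lemma fps_eval_eqm_sum N f :
  fps_eqm N (fps_eval f) (\sum_(k < N) h (fps_coef f k) * T ^+ k).
Proof.
move=> n ltnN; rewrite -(subnKC ltnN) big_split_ord fps_coefD /=.
rewrite -[LHS]addr0; congr (_ + _); rewrite fps_coef_sum big1 // => k _.
by rewrite exprMn mulrCA fps_coefXnM leq_addr.
Qed.

Lemma fps_eval_eqm N f :
  fps_eqm N (fps_eval f) (map_poly h (fps_trunc N f)).[T].
Proof.
have szN : (size (map_poly h (fps_trunc N f)) <= N)%N.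
  exact: leq_trans (size_poly _ _) (size_poly _ _).
apply: fps_eqm_trans (fps_eval_eqm_sum f) _ => n ltnN.
rewrite (horner_coef_wide _ szN); congr (fps_coef _ n).
by apply: eq_bigr => k _; rewrite coef_map coef_poly ltn_ord.
Qed.

Lemma fps_eval_zmod : zmod_morphism fps_eval.
Proof.
move=> f g; apply/fpsP => n; rewrite fps_coefD fps_coefN /= -fps_coefN.
rewrite -fps_coefD -sumrB; congr (fps_coef _ n).
by apply: eq_bigr => k _; rewrite -mulrBl -rmorphB.
Qed.

Lemma fps_eval_monoid : monoid_morphism fps_eval.
Proof.
split=> [|f g]; apply/fpsP => n.
  rewrite fps_evalE big_ord_recl expr0 mulr1 big1 => [|k _].
    by rewrite addr0 [fps_coef 1 _]/= rmorph1.
  by rewrite [fps_coef 1 _]/= rmorph0 mul0r.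
rewrite (fps_eval_eqm (f * g) (ltnSn n)).
rewrite (fps_eqmM (@fps_eval_eqm n.+1 f) (@fps_eval_eqm n.+1 g) (ltnSn n)).
(* The product of the truncations differs from the truncation of the product by a multiple of
   ['X^n.+1], whose value at [T] has no coefficient of index n. *)
rewrite -hornerM -rmorphM -[fps_trunc _ f * _](poly_take_drop n.+1).
have -> : take_poly n.+1 (fps_trunc n.+1 f * fps_trunc n.+1 g) =
    fps_trunc n.+1 (f * g).
  apply/polyP => k; rewrite coef_take_poly coef_poly.
  by case: ifP => // ltkn; rewrite -coef_fps_mul_trunc.
rewrite rmorphD rmorphM /= map_polyXn hornerD hornerM hornerXn.
by rewrite exprMn mulrCA fps_coefD fps_coefXnM leqnn addr0.
Qed.

HB.instance Definition _ :=
  GRing.isZmodMorphism.Build (fps A) (fps B) fps_eval fps_eval_zmod.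
HB.instance Definition _ :=
  GRing.isMonoidMorphism.Build (fps A) (fps B) fps_eval fps_eval_monoid.

Lemma fps_eval_const a : fps_eval (fps_const a) = h a.
Proof.
apply/fpsP => n; rewrite fps_evalE big_ord_recl expr0 mulr1 big1 => [|k _].
  by rewrite addr0 fps_coef_const.
by rewrite fps_coef_const rmorph0 mul0r.
Qed.

Lemma fps_eval_var : fps_eval (fps_var A) = T.
Proof.
apply/fpsP => n; rewrite (@fps_eval_eqm_sum n.+2) //.
rewrite 2!big_ord_recl big1 => [|k _]; last by rewrite fps_coefX rmorph0 mul0r.
by rewrite !fps_coefX rmorph0 rmorph1 mul0r add0r addr0 mul1r.
Qed.

Lemma fps_eval_coef0 f : fps_coef (fps_eval f) 0 = fps_coef (h (fps_coef f 0)) 0.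
Proof. by rewrite fps_evalE big_ord1 expr0 mulr1. Qed.

End FpsEval.

Lemma fps_eval_map (A B C : comNzRingType) (h : {rmorphism B -> fps C})
    (h' : {rmorphism A -> fps C}) (k : {rmorphism A -> B}) T1 f :
    h \o k =1 h' ->
  fps_eval h T1 (fps_map k f) = fps_eval h' T1 f.
Proof.
move=> hk; apply/fpsP => n /=; congr (fps_coef _ n).
by apply: eq_bigr => i _; rewrite -hk.
Qed.

(** A nonzero series is [t^m k] with [k] of nonzero constant term; substitution keeps that constant
    term, and [T ^+ m] is nonzero. *)
Lemma fps_eval_inj (A : idomainType) T1 : T1 != 0 ->
  injective (fps_eval (@fps_const A) T1).
Proof.
move=> nzT1 f g /eqP; rewrite -subr_eq0 -rmorphB => eq0; apply/eqP.
rewrite -subr_eq0; apply: contraTT eq0 => /fps_neq0_factor[m [k -> nz_k]].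
rewrite rmorphM rmorphXn /= fps_eval_var fps_mulf_neq0 ?fps_expf_neq0 //.
  rewrite fps_mulf_neq0 //; apply/eqP => /fpsP/(_ 1%N)/eqP /=.
  by rewrite coefX oner_eq0.
apply/eqP => /fpsP/(_ 0%N)/eqP.
by rewrite fps_eval_coef0 fps_coef_const (negPf nz_k).
Qed.

(** * Counting walks by their last step *)

Lemma big_rcons_tuple (T : finType) n (F : n.+1.-tuple T -> nat) :
  (\sum_w F w = \sum_s \sum_(w : n.-tuple T) F (rcons_tuple w s))%N.
Proof.
rewrite pair_bigA /= (reindex (fun p : T * n.-tuple T => rcons_tuple p.2 p.1)) //.
apply: onW_bij; apply: inj_card_bij => [[s w] [s' w'] /= | ].
  by move/(congr1 val)/rcons_inj => [/val_inj -> ->].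
by rewrite card_prod !card_tuple expnS.
Qed.

Lemma big_seq_sub (T : choiceType) (s : seq T) (F : T -> nat) :
  uniq s -> (\sum_(x : seq_sub s) F (ssval x) = \sum_(x <- s) F x)%N.
Proof.
move=> Us; rewrite -[in RHS](val_seq_sub_enum Us) big_map.
by rewrite -big_enum enumT [Finite.enum]unlock.
Qed.

Section Walks.
Variable S : seq (int * int).

Lemma endpoint_rcons (w : seq (seq_sub S)) s :
  endpoint (rcons w s) = endpoint w + ssval s.
Proof. by rewrite /endpoint -cats1 big_cat big_seq1. Qed.

Lemma quadrant_walk_rcons n (w : n.-tuple (seq_sub S)) s :
  quadrant_walk (rcons_tuple w s) =
  quadrant_walk w && quadrant (endpoint w + ssval s).
Proof.
rewrite -endpoint_rcons; apply/forallP/andP => [qw | [/forallP qw qs] k].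
  split; last by have:= qw ord_max; rewrite /= take_oversize ?size_rcons ?size_tuple.
  apply/forallP => k; have:= qw (widen_ord (leqnSn _) k).
  by rewrite /= -cats1 takel_cat // size_tuple leq_ord.
have [lekn | ltnk] := leqP k n; last first.
  by rewrite take_oversize // size_rcons size_tuple.
have:= qw (Ordinal (lekn : (k < n.+1)%N)).
by rewrite /= -cats1 takel_cat // size_tuple.
Qed.

(** The target is any integer point, because undoing a step may lead out of the quadrant. *)
Definition walks_to n (p : int * int) : nat :=
  #|[set w : n.-tuple (seq_sub S) | quadrant_walk w && (endpoint w == p)]|.

Lemma walks_to_outside n p : ~~ quadrant p -> walks_to n p = 0%N.
Proof.
move=> qp; apply/eqP; rewrite cards_eq0; apply/eqP/setP => w; rewrite !inE.
apply: contraNF qp => /andP[/forallP/(_ ord_max)].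
by rewrite /= take_oversize ?size_tuple // => qw /eqP <-.
Qed.

Lemma walks_to0 p : walks_to 0 p = (p == 0).
Proof.
have e0 : endpoint ([tuple] : 0.-tuple (seq_sub S)) = 0 by rewrite /endpoint big_nil.
rewrite /walks_to; case: (p =P 0) => [-> | np].
  rewrite (_ : [set _ | _] = [set: 0.-tuple (seq_sub S)]) ?cardsT ?card_tuple //.
  apply/setP => w; rewrite !inE tuple0 e0 eqxx andbT.
  by apply/forallP => k; rewrite /endpoint big_nil.
apply/eqP; rewrite cards_eq0; apply/eqP/setP => w; rewrite !inE tuple0 e0.
by case: (0 =P p) => [/esym /np // | _]; rewrite andbF.
Qed.

Lemma walks_toS n p : uniq S -> quadrant p ->
  (walks_to n.+1 p = \sum_(s <- S) walks_to n (p - s)%R)%N.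
Proof.
move=> US qp; rewrite -(big_seq_sub (fun s => walks_to n (p - s)) US).
rewrite /walks_to -sum1dep_card big_mkcond big_rcons_tuple.
apply: eq_bigr => s _; rewrite -sum1dep_card [RHS]big_mkcond.
apply: eq_bigr => w _; rewrite quadrant_walk_rcons endpoint_rcons.
rewrite [endpoint w == _]eq_sym subr_eq eq_sym.
by case: eqP => [<- | _]; rewrite ?andbF ?qp ?andbT.
Qed.

End Walks.

Lemma walk_countE S i j n : walk_count S i j n = walks_to S n (i%:Z, j%:Z).
Proof. by []. Qed.

Lemma walk_count0 i j : walk_count revKreweras i j 0 = ((i == 0%N) && (j == 0%N)).
Proof. by rewrite walk_countE walks_to0 xpair_eqE. Qed.

Lemma walk_countS i j n : walk_count revKreweras i j n.+1 =
  ((if j is j'.+1 then walk_count revKreweras i j' n else 0) +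
   (if i is i'.+1 then walk_count revKreweras i' j n else 0) +
   walk_count revKreweras i.+1 j.+1 n)%N.
Proof.
rewrite !walk_countE walks_toS // !big_cons big_nil addn0 addnA.
have subE (a b c d : int) : (a, b) - (c, d) = (a - c, b - d) by [].
rewrite !subE !subr0 !opprK -!PoszD !addn1; congr (_ + _ + _)%N.
  by case: j => [|j]; [rewrite walks_to_outside | rewrite -addn1 PoszD addrK].
by case: i => [|i]; [rewrite walks_to_outside | rewrite -addn1 PoszD addrK].
Qed.

Lemma walk_count_sym i j n :
  walk_count revKreweras i j n = walk_count revKreweras j i n.
Proof.
elim: n i j => [|n IHn] i j; first by rewrite !walk_count0 andbC.
rewrite !walk_countS (IHn i.+1); congr addn; rewrite addnC.
by congr addn; [case: i | case: j] => // k; rewrite IHn.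
Qed.

(** * The functional equation; [axisGF] is R(x) and [originGF] is R(0) *)

Definition axisGF : fps {poly rat} := Fps (fun n => (fps_coef revKrewerasGF n)`_0).
Definition originGF : fps rat := Fps (fun n => (fps_coef axisGF n)`_0).

Lemma coef_var_x p i j :
  (var_x * p)`_j`_i = if i is i'.+1 then p`_j`_i' else 0.
Proof. by rewrite coefCM coefXM; case: i. Qed.

Lemma coef_var_y p i j :
  (var_y * p)`_j`_i = if j is j'.+1 then p`_j'`_i else 0.
Proof. by rewrite coefXM; case: j => //=; rewrite coef0. Qed.

Definition axis_x : fps {poly rat} -> fps {poly {poly rat}} := fps_map polyC.
Definition axis_y : fps {poly rat} -> fps {poly {poly rat}} :=
  fps_map (map_poly polyC).
HB.instance Definition _ := GRing.RMorphism.on axis_x.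
HB.instance Definition _ := GRing.RMorphism.on axis_y.

Definition x_poly2 : fps {poly {poly rat}} := fps_const var_x.
Definition y_poly2 : fps {poly {poly rat}} := fps_const var_y.
Definition t_poly2 : fps {poly {poly rat}} := fps_var _.

Local Notation x2 := x_poly2.
Local Notation y2 := y_poly2.
Local Notation t2 := t_poly2.

Definition kernel := x2 * y2 - t2 * (x2 ^+ 2 * y2 + x2 * y2 ^+ 2 + 1).

(** The step (-1,-1) is forbidden from the two axes, whose walks are counted by Q(x,0) + Q(0,y) -
    Q(0,0). By symmetry Q(0,y) = R(y). *)
Lemma functional_equation :
  kernel * revKrewerasGF = x2 * y2 - t2 * axis_x axisGF - t2 * axis_y axisGF
    + t2 * axis_x (fps_map polyC originGF).
Proof.
set p := var_x * (var_x * var_y) + var_x * (var_y * var_y) + 1.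
have -> : kernel = fps_const (var_x * var_y) - t2 * fps_const p.
  by rewrite /p !(rmorphD, rmorphM, rmorph1) /=; rewrite /kernel; ring.
have -> : x2 * y2 = fps_const (var_x * var_y) by rewrite rmorphM.
rewrite mulrBl -mulrA; apply/fpsP => -[|n].
  rewrite !(fps_coefD, fps_coefN) !fps_coefXM fps_coefCM fps_coef_const.
  rewrite !subr0 addr0 -[RHS]mulr1; congr (_ * _).
  apply/polyP => j; apply/polyP => i.
  rewrite coef_revKrewerasGF walk_count0 coef1.
  by case: j => [|j]; rewrite ?coef0 ?coef1 ?andbT ?andbF.
rewrite !(fps_coefD, fps_coefN) !fps_coefXM !fps_coefCM fps_coef_const sub0r.
rewrite /p !mulrDl mul1r -!mulrA; apply/polyP => j; apply/polyP => i.
rewrite !(coefD, coefN) !(coef_var_x, coef_var_y) !coefC.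
rewrite coef_map /=.
(* The monomials x^2 y and x y^2 shift exponents by up to 2, so the exponents 0, 1 and at least 2
   are separated. *)
case: i j => [|[|i]] [|[|j]]; rewrite ?(coef_var_x, coef_var_y) ?coefC ?coef0
  ?eqxx ?coef_revKrewerasGF ?walk_countS ?natrD /= ?coef_revKrewerasGF
  ?(walk_count_sym _.+1 0); ring.
Qed.

(** * The Tutte invariant and its vanishing *)

(* [t x (L^2 - I^2/4 - a I - b)], with [rho = t R(x)] and [c = t b + 1]. *)
Definition invariant_of (R : comNzRingType) (x t rho a c : R) : R :=
  rho * (t - x ^+ 2 + t * x ^+ 3) - 2 * a * t + t * x * (rho - a) ^+ 2
  - c * x + t * x ^+ 2.

Lemma rmorph_invariant_of (R S : comNzRingType) (f : {rmorphism R -> S})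
    (x t rho a c : R) :
  f (invariant_of x t rho a c) = invariant_of (f x) (f t) (f rho) (f a) (f c).
Proof. by rewrite /invariant_of; ring. Qed.

(** The inverse is the fixed point of the contraction sending v to 1 - t g v. *)
Lemma fps_unit_inverse (R : comNzRingType) (g : fps R) :
  exists v, (1 + fps_var R * g) * v = 1.
Proof.
have [n f f' ff'|v vE] := @fps_contraction_fixpoint R (fun v => 1 - fps_var R * (g * v)).
  by apply: fps_eqmD => //; apply/fps_eqmN/fps_eqmXM/fps_eqmM.
by exists v; rewrite mulrDl mul1r -mulrA -{1}vE subrK.
Qed.

Definition x_poly : fps {poly rat} := fps_const 'X.
Definition t_poly : fps {poly rat} := fps_var _.
Definition const_x : fps rat -> fps {poly rat} := fps_map polyC.
HB.instance Definition _ := GRing.RMorphism.on const_x.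

(* [half_origin] and [linear_coef] are the [a] and [t b + 1] of the header. *)
Definition half_origin : fps rat := fps_const 2^-1 * (fps_var _ * originGF).
Definition axis1 : fps rat := Fps (fun n => (fps_coef axisGF n)`_1).
Definition linear_coef : fps rat :=
  fps_var _ ^+ 2 * axis1 + fps_var _ * half_origin ^+ 2.

Local Notation x := x_poly.
Local Notation t := t_poly.
Local Notation a := (const_x half_origin).
Local Notation c := (const_x linear_coef).
Local Notation rho := (t * axisGF).

Definition tutte_invariant : fps {poly rat} := invariant_of x t rho a c.

Lemma double_half_origin : 2 * half_origin = fps_var _ * originGF.
Proof.
rewrite /half_origin mulrA -(rmorph_nat (@fps_const rat)) -rmorphM.
by rewrite mulfV // rmorph1 mul1r.
Qed.

Lemma const_x_var : const_x (fps_var _) = t.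
Proof. exact: fps_map_var. Qed.

Lemma double_a : 2 * a = t * const_x originGF.
Proof.
by rewrite -(rmorph_nat const_x) -rmorphM double_half_origin rmorphM /= const_x_var.
Qed.

(** The choice of [a] as half of [rho] at x = 0 kills the coefficient of x^0, and the formula for
    [linear_coef] is the one that kills the coefficient of x^1. *)
Lemma invariant_dvdX2 : exists g, tutte_invariant = x ^+ 2 * g.
Proof.
pose r2 : fps {poly rat} := Fps (fun n => drop_poly 2 (fps_coef axisGF n)).
have axisE : axisGF = const_x originGF + x * const_x axis1 + x ^+ 2 * r2.
  rewrite /x_poly -rmorphXn; apply/fpsP => n.
  rewrite !fps_coefD !fps_coefCM -[LHS](poly_take_drop 2) mulrC.
  congr (_ + _); apply/polyP => -[|[|i]];
    by rewrite coef_take_poly coefD coefXM /= !coefC /= ?addr0 ?add0r.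
have rhoE : rho = 2 * a + x * (t * const_x axis1) + x ^+ 2 * (t * r2).
  by rewrite double_a axisE; ring.
have cE : c = t ^+ 2 * const_x axis1 + t * a ^+ 2.
  by rewrite rmorphD rmorphM rmorphXn rmorphM rmorphXn /= const_x_var.
rewrite /tutte_invariant /invariant_of rhoE cE; set r1 := const_x axis1.
(* By [rhoE], [s] is [rho] and [w] is its quotient (rho - 2 a) / x. *)
pose w := t * r1 + x * (t * r2); pose s := 2 * a + x * w.
exists (t * (t * r2) - s + s * t * x + 2 * a * t * w + t * x * w ^+ 2 + t).
rewrite /s /w; ring.
Qed.

Lemma axis_constE f : axis_y (const_x f) = axis_x (const_x f).
Proof. by apply/fpsP => n /=; rewrite map_polyC. Qed.

Lemma axis_x_var : axis_x t = t2. Proof. exact: fps_map_var. Qed.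
Lemma axis_y_var : axis_y t = t2. Proof. exact: fps_map_var. Qed.
Lemma axis_x_x : axis_x x = x2. Proof. exact: fps_map_const. Qed.
Lemma axis_y_x : axis_y x = y2.
Proof. by rewrite [LHS]fps_map_const /= map_polyX. Qed.

(** The left side is t x y times the difference of the invariants at x and y. It is divisible by K
    since t x y (I(x) - I(y)) = (x - y) K and, by the functional equation, L(x) + L(y) = - K (Q + (x
    + y) / (2 t x y)). *)
Lemma kernel_dvd_invariant : exists g,
  y2 * axis_x tutte_invariant - x2 * axis_y tutte_invariant = kernel * g.
Proof.
pose sy := axis_y rho; pose sx := axis_x rho; pose a2 := axis_x a.
have feq : kernel * revKrewerasGF = x2 * y2 - sx - sy + 2 * a2.
  rewrite functional_equation /sx /sy !rmorphM /= axis_x_var axis_y_var.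
  suff -> : 2 * a2 = t2 * axis_x (const_x originGF) by [].
  by rewrite -axis_x_var -rmorphM -double_a rmorphM rmorph_nat.
have syE : sy = x2 * y2 - sx + 2 * a2 - kernel * revKrewerasGF.
  by rewrite feq; ring.
have iE : axis_x tutte_invariant = invariant_of x2 t2 sx a2 (axis_x c).
  by rewrite [LHS]rmorph_invariant_of /= axis_x_x axis_x_var.
have jE : axis_y tutte_invariant = invariant_of y2 t2 sy a2 (axis_x c).
  by rewrite [LHS]rmorph_invariant_of /= axis_y_x axis_y_var !axis_constE.
exists (- t2 * (y2 - x2) * revKrewerasGF - x2 * sx + y2 * sy
  - t2 * x2 * y2 * revKrewerasGF * (sx - sy)).
rewrite iE jE /invariant_of syE /kernel; ring.
Qed.

Lemma x_poly_neq0 : x != 0.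
Proof.
by apply/eqP => /fpsP/(_ 0%N)/eqP; rewrite fps_coef_const eqxx polyX_eq0.
Qed.

Lemma fps_var_neq0 (R : comNzRingType) : fps_var R != 0.
Proof. by apply/eqP => /fpsP/(_ 1%N)/eqP; rewrite fps_coefX oner_eq0. Qed.

(* The curve [kernel = 0] is parametrized by x and y, as t is a rational function
   of them: [t = xy / (1 + x^2 y + x y^2)], a power series in y. *)
Lemma kernel_parametrization : exists T1 : fps {poly rat}, T1 != 0 /\
  fps_eval (@fps_of_poly {poly rat}) T1 kernel = 0.
Proof.
(* In the target ring the series variable, written [t], stands for y; thus [v] is 1 / (1 + x^2 y + x
   y^2). *)
have [v vE] := fps_unit_inverse (x ^+ 2 + x * t); exists (x * v); split.
  apply: fps_mulf_neq0 x_poly_neq0 _; apply: contra_eq_neq vE => ->.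
  by rewrite mulr0 eq_sym oner_neq0.
pose ev := fps_eval (@fps_of_poly {poly rat}) (x * v).
have ev_x2 : ev x2 = x by exact: fps_eval_const.
have ev_y2 : ev y2 = t by exact: fps_eval_const.
have ev_t2 : ev t2 = t * (x * v) by exact: fps_eval_var.
rewrite rmorphB !rmorphM rmorphD rmorphD !rmorphM /= rmorph1.
rewrite -/ev ev_x2 ev_y2 ev_t2.
transitivity (x * t * (1 - (1 + t * (x ^+ 2 + x * t)) * v)); first by ring.
by rewrite vE subrr mulr0.
Qed.

(** Write the invariant as x^2 k. On the curve, y x^2 k(x) = x y^2 k(y), that is, x k(x) = y k(y).
    If k were nonzero, dividing by the largest power of t in it and setting y = 0, where t vanishes
    too, would give x k'(x;0) = 0 with k'(x;0) nonzero. *)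
Lemma invariant_eq0 : tutte_invariant = 0.
Proof.
have [T1 [nzT1 kernel0]] := kernel_parametrization.
have [g gE] := kernel_dvd_invariant; have [k kE] := invariant_dvdX2.
pose ev : {rmorphism fps {poly {poly rat}} -> fps {poly rat}} :=
  fps_eval (@fps_of_poly {poly rat}) T1.
pose evx : {rmorphism fps {poly rat} -> fps {poly rat}} :=
  fps_eval (@fps_const {poly rat}) T1.
pose evy : {rmorphism fps {poly rat} -> fps {poly rat}} :=
  fps_eval (@fps_of_poly {poly rat} \o map_poly polyC) T1.
have evxE f : ev (axis_x f) = evx f by exact: fps_eval_map.
have evyE f : ev (axis_y f) = evy f by exact: fps_eval_map.
have ev_x2 : ev x2 = x by exact: fps_eval_const.
have ev_y2 : ev y2 = t by exact: fps_eval_const.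
have evx_x : evx x = x by exact: fps_eval_const.
have evy_x : evy x = t by rewrite [LHS]fps_eval_const /= map_polyX.
have evx_t : evx t = t * T1 by exact: fps_eval_var.
have evy_t : evy t = t * T1 by exact: fps_eval_var.
have eq_inv : t * evx tutte_invariant = x * evy tutte_invariant.
  apply/eqP; rewrite -subr_eq0 -evxE -evyE -ev_x2 -ev_y2 -!rmorphM -rmorphB.
  by rewrite gE rmorphM [ev kernel]kernel0 mul0r.
rewrite kE; suff -> : k = 0 by rewrite mulr0.
apply/eqP/negP => /negP /fps_neq0_factor[m [k' def_k nz_k']].
(* The two copies of k carry the same power of t, so this factor is common to both sides and can be
   cancelled. *)
have : (x * t * (t * T1) ^+ m) * (x * evx k') = (x * t * (t * T1) ^+ m) * (t * evy k').
  transitivity (t * evx tutte_invariant); last rewrite eq_inv.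
    by rewrite kE def_k !(rmorphM, rmorphXn) evx_x evx_t; ring.
  by rewrite kE def_k !(rmorphM, rmorphXn) evy_x evy_t; ring.
have nz_xtT : x * t * (t * T1) ^+ m != 0.
  by rewrite !(fps_mulf_neq0, fps_expf_neq0) ?x_poly_neq0 ?fps_var_neq0.
move/(fps_mulfI nz_xtT).
move/fpsP/(_ 0%N)/eqP; rewrite fps_coefM0 fps_coefXM fps_coef_const eqxx.
rewrite fps_eval_coef0 fps_coef_const eqxx mulf_eq0 polyX_eq0.
by rewrite (negPf nz_k').
Qed.

(* [root_of] is [2 x t L] and [disc_of] is [4 x^2 t^2 (I^2/4 + a I + b)]. *)
Definition root_of (R : comNzRingType) (x t rho a : R) : R :=
  t - x ^+ 2 + t * x ^+ 3 + 2 * x * t * (rho - a).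

Definition disc_of (R : comNzRingType) (x t a c : R) : R :=
  (t + x ^+ 2 - t * x ^+ 3) ^+ 2 + 4 * a * t * x * (t + x ^+ 2 - t * x ^+ 3)
  + 4 * t * (c - 1) * x ^+ 2.

Lemma rmorph_root_of (R S : comNzRingType) (f : {rmorphism R -> S})
    (x t rho a : R) :
  f (root_of x t rho a) = root_of (f x) (f t) (f rho) (f a).
Proof. by rewrite /root_of; ring. Qed.

Lemma rmorph_disc_of (R S : comNzRingType) (f : {rmorphism R -> S})
    (x t a c : R) :
  f (disc_of x t a c) = disc_of (f x) (f t) (f a) (f c).
Proof. by rewrite /disc_of; ring. Qed.

Lemma root_sqr : root_of x t rho a ^+ 2 = disc_of x t a c.
Proof.
apply/eqP; rewrite -subr_eq0; apply/eqP.
transitivity (4 * x * t * tutte_invariant); last by rewrite invariant_eq0 mulr0.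
by rewrite /root_of /disc_of /tutte_invariant /invariant_of; ring.
Qed.

(** * The derivative in x, and the critical points of I *)

Section Derivative.
Variable R : comNzRingType.
Implicit Types f g : fps {poly R}.

Definition coef_deriv f : fps {poly R} := Fps (fun n => (fps_coef f n)^`()).

Lemma coef_deriv_zmod : zmod_morphism coef_deriv.
Proof. by move=> f g; apply/fpsP => n /=; rewrite derivB. Qed.

HB.instance Definition _ :=
  GRing.isZmodMorphism.Build (fps {poly R}) (fps {poly R}) coef_deriv
    coef_deriv_zmod.

Lemma coef_derivM f g :
  coef_deriv (f * g) = coef_deriv f * g + f * coef_deriv g.
Proof.
apply/fpsP => n; rewrite fps_coefD !fps_coefM /= raddf_sum -big_split /=.
by apply: eq_bigr => k _; rewrite derivM.
Qed.

Lemma coef_deriv_x : coef_deriv (fps_const 'X) = 1.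
Proof.
by apply/fpsP => -[|n]; rewrite /= coefC /= ?derivX ?deriv0.
Qed.

Lemma coef_deriv_map (f : fps R) : coef_deriv (fps_map polyC f) = 0.
Proof. by apply/fpsP => n /=; rewrite derivC. Qed.

End Derivative.

Section DoubleRoot.
Variables (z1 T1 : fps rat).
Hypothesis z1_neq0 : fps_coef z1 0 != 0.
Local Notation u := (fps_var rat).
Local Notation z := (u * z1).
Local Notation T := (u * T1).
Hypothesis crit_z : z ^+ 2 = T * (1 + 2 * z ^+ 3).

(** [ev] substitutes [z] for x and [T] for t; [evc] does the same on series free of x. *)
Let h : {rmorphism {poly rat} -> fps rat} :=
  horner_morph (fun b => mulrC z (fps_const b)).
Let ev : {rmorphism fps {poly rat} -> fps rat} := fps_eval h T1.
Let evc : {rmorphism fps rat -> fps rat} := fps_eval (@fps_const rat) T1.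

(** With [p] and [p'] the values at [z] of 2 x t L and of its x-derivative, p - z p' = - 2 z^2 T L'.
    So [twist] says L L' = 0 at the critical point, and it remains to see that L' is not zero
    there. *)
Lemma critical_disc_eq0 : disc_of z T (evc half_origin) (evc linear_coef) = 0.
Proof.
have ev_x : ev x = z by rewrite [LHS]fps_eval_const /= horner_morphX.
have ev_t : ev t = T by exact: fps_eval_var.
have ev_const f : ev (const_x f) = evc f.
  by apply: fps_eval_map => b /=; rewrite horner_morphC.
set A := evc _; set C := evc _; pose r := ev rho; pose q := ev (coef_deriv rho).
pose p := root_of z T r A.
have pE : p ^+ 2 = disc_of z T A C.
  have := congr1 ev root_sqr.
  by rewrite rmorphXn rmorph_root_of rmorph_disc_of !ev_const ev_x ev_t.
pose p' := - 2 * z + 3 * T * z ^+ 2 + 2 * T * (r - A) + 2 * z * T * q.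
pose w := T + z ^+ 2 - T * z ^+ 3; pose w' := 2 * z - 3 * T * z ^+ 2.
have dpE : 2 * p * p' = 2 * w * w' + 4 * A * T * (w + z * w') + 8 * T * (C - 1) * z.
  have dt : coef_deriv t = 0 by rewrite -const_x_var coef_deriv_map.
  have dx : coef_deriv x = 1 by exact: coef_deriv_x.
  have dn n : coef_deriv n%:R = 0 :> fps {poly rat}.
    by rewrite -(rmorph_nat const_x) coef_deriv_map.
  have da f : coef_deriv (const_x f) = 0 by exact: coef_deriv_map.
  pose W := t + x ^+ 2 - t * x ^+ 3.
  have dW : coef_deriv W = 2 * x - 3 * t * x ^+ 2.
    rewrite /W !(exprS, expr0, mulr1) !(raddfB, raddfD) /= !coef_derivM dt dx.
    by ring.
  have dP g : coef_deriv (root_of x t g a) =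
      - 2 * x + 3 * t * x ^+ 2 + 2 * t * (g - a) + 2 * x * t * coef_deriv g.
    rewrite /root_of !(exprS, expr0, mulr1) !(raddfB, raddfD) /= !coef_derivM.
    by rewrite raddfB /= ?dn dt dx da; ring.
  have dDisc : coef_deriv (disc_of x t a c) =
      2 * W * coef_deriv W + 4 * a * t * (W + x * coef_deriv W)
      + 8 * t * (c - 1) * x.
    have -> : disc_of x t a c =
        W * W + 4%:R * a * t * x * W + 4%:R * t * (c - 1%:R) * x * x.
      by rewrite /disc_of /W; ring.
    move: W linear_coef {dW} => W k; rewrite !raddfD /= !coef_derivM raddfB /= !dn dt dx !da.
    by ring.
  have evP g b k : ev ((- 2 * x + 3 * t * x ^+ 2 + 2 * t * (g - b) + 2 * x * t * k)
        * root_of x t g b) = (- 2 * z + 3 * T * z ^+ 2 + 2 * T * (ev g - ev b)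
        + 2 * z * T * ev k) * root_of z T (ev g) (ev b).
    by rewrite /root_of -ev_x -ev_t; ring.
  have evDisc b k : ev (2 * W * (2 * x - 3 * t * x ^+ 2)
        + 4 * b * t * (W + x * (2 * x - 3 * t * x ^+ 2)) + 8 * t * (k - 1) * x) =
      2 * w * w' + 4 * ev b * T * (w + z * w') + 8 * T * (ev k - 1) * z.
    by rewrite /W /w /w' -ev_x -ev_t; ring.
  have := congr1 (fun f => ev (coef_deriv f)) root_sqr.
  rewrite expr2 coef_derivM dP dDisc dW evDisc !ev_const => <-.
  rewrite [X in _ + X]mulrC -mulr2n raddfMn /= evP ev_const -[RHS]mulr_natl.
  by rewrite /p' /p /r /q; ring.
have twist : 2 * p * (p - z * p') = 0.
  transitivity (2 * p ^+ 2 - z * (2 * p * p')); first by ring.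
  rewrite dpE pE /disc_of -/w.
  transitivity (- (2 * w + 4 * A * T * z) * (z ^+ 2 - T * (1 + 2 * z ^+ 3))).
    by rewrite /w /w'; ring.
  by rewrite crit_z subrr mulr0.
have p0 : p = 0.
  (* Modulo the equation of [z], (1 + 2 z^3) (p - z p') equals 2 z^2 (1 - z^2 q), whose last factor
     has constant term 1. *)
  have : z ^+ 2 * (4 * (1 - z ^+ 2 * q)) * p = 0.
    transitivity ((1 + 2 * z ^+ 3) * (2 * p * (p - z * p'))
        + 2 * p * (1 - 2 * z ^+ 3 - 2 * z ^+ 2 * q)
          * (z ^+ 2 - T * (1 + 2 * z ^+ 3))); last first.
      by rewrite twist crit_z subrr !mulr0 addr0.
    by rewrite /p /p' /root_of; ring.
  rewrite -[RHS](mulr0 (z ^+ 2 * (4 * (1 - z ^+ 2 * q)))); apply: fps_mulfI.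
  have z_neq0 : z != 0.
    rewrite fps_mulf_neq0 ?fps_var_neq0 //.
    by apply: contraNneq z1_neq0 => ->.
  rewrite fps_mulf_neq0 ?fps_expf_neq0 //.
  rewrite -(rmorph_nat (@fps_const rat)); apply/eqP => /fpsP/(_ 0%N)/eqP.
  rewrite fps_coefCM fps_coefD fps_coefN expr2 -!mulrA fps_coefXM subr0.
  by rewrite mulr1.
by rewrite -pE p0 expr0n.
Qed.
End DoubleRoot.

(** * Solving for [a] and [c] from two critical points *)

Lemma fps_coef0_neq0 (R : comNzRingType) (f : fps R) :
  fps_coef f 0 != 0 -> f != 0.
Proof. by apply: contraNneq => ->. Qed.

Lemma fps_natr_coef0 (R : comNzRingType) n : fps_coef (n%:R : fps R) 0 = n%:R.
Proof. by rewrite -(rmorph_nat (@fps_const R)) fps_coef_const. Qed.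

(** At a critical point T + z^2 - T z^3 = T (2 + z^3), so a factor [T] comes out. *)
Lemma disc_of_critical (R : comNzRingType) (z T a c : R) :
    z ^+ 2 = T * (1 + 2 * z ^+ 3) ->
  disc_of z T a c = T * (T * (2 + z ^+ 3) ^+ 2 + 4 * a * z * T * (2 + z ^+ 3)
    + 4 * (c - 1) * z ^+ 2).
Proof.
move=> crit; have d0 : z ^+ 2 - T * (1 + 2 * z ^+ 3) = 0 by rewrite crit subrr.
rewrite -[RHS]addr0.
rewrite -[X in _ + X](mul0r (T * (2 + z ^+ 3) + (T + z ^+ 2 - T * z ^+ 3) + 4 * a * T * z)).
by rewrite -[X in X * (T * (2 + z ^+ 3) + _ + _)]d0 /disc_of; ring.
Qed.

(** The witness [h] is T f with f = u u'. Since u + u' = 2 f^2, the symmetric functions of u and u'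
    are polynomials in f. The cubic of f has leading coefficient 4 T; passing to T f leaves the unit
    4, and T^4 clears the denominators in [a] and [c]. *)
Lemma critical_values : exists T1 h : fps rat,
  let T := fps_var _ * T1 in let ev := fps_eval (@fps_const rat) T1 in
  [/\ T1 != 0, 4 * h ^+ 3 = T * h + T ^+ 3,
      2 * T ^+ 4 * ev half_origin = - (T ^+ 3 * h + 2 * h ^+ 4) &
      4 * T ^+ 4 * ev linear_coef = 5 * T ^+ 3 * h ^+ 2 + 16 * h ^+ 5].
Proof.
pose u := fps_var rat; have nzu : u != 0 := fps_var_neq0 _.
have [v vE] := fps_unit_inverse (2 * u ^+ 2).
(* Equality of z^2 / (1 + 2 z^3) at u and u' reads (u' - u) (u + u' - 2 (u u')^2) = 0; the second
   factor is solved for u'. *)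
have [n f f' ff'|u' u'E] :=
    @fps_contraction_fixpoint rat (fun f => - u + u * (2 * u * f ^+ 2)).
  by apply/fps_eqmD/fps_eqmXM/fps_eqmM/fps_eqmM.
have {}u'E : - u + u * (2 * u * u' ^+ 2) = u' by exact: u'E.
pose z1 := - 1 + 2 * u * u' ^+ 2.
have z1E : u' = u * z1 by rewrite -[LHS]u'E /z1; ring.
have z10 : fps_coef z1 0 = -1.
  by rewrite /z1 [2 * u]mulrC -mulrA fps_coefD fps_coefXM addr0.
pose T1 := u * v; pose T := u * T1.
have nzT1 : T1 != 0.
  apply: fps_mulf_neq0 => //; apply: contra_eq_neq vE => ->.
  by rewrite mulr0 eq_sym oner_neq0.
have nzT : T != 0 by apply: fps_mulf_neq0.
have vE' : v * (1 + 2 * u ^+ 3) = 1 by rewrite -[RHS]vE /u; ring.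
have crit_u : u ^+ 2 = T * (1 + 2 * u ^+ 3).
  by rewrite -[LHS]mulr1 -[X in _ * X = _]vE' /T /T1; ring.
have sum_u : u + u' = 2 * (u * u') ^+ 2.
  by rewrite -[X in u + X]u'E; ring.
have crit_u' : u' ^+ 2 = T * (1 + 2 * u' ^+ 3).
  rewrite -[LHS]mulr1 -[X in _ * X = _]vE' /T /T1; apply/eqP; rewrite -subr_eq0; apply/eqP.
  transitivity (v * (u' - u) * (u + u' - 2 * (u * u') ^+ 2)); first by ring.
  by rewrite sum_u subrr mulr0.
pose ev := fps_eval (@fps_const rat) T1.
pose A := 4 * ev half_origin; pose C := 4 * (ev linear_coef - 1).
have lin (s : fps rat) (z := u * s) : fps_coef s 0 != 0 ->
    z ^+ 2 = T * (1 + 2 * z ^+ 3) ->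
    T * (2 + z ^+ 3) ^+ 2 + A * z * T * (2 + z ^+ 3) + C * z ^+ 2 = 0.
  move=> nz_s crit; apply: (fps_mulfI nzT); rewrite mulr0.
  by rewrite -(disc_of_critical _ _ crit); apply: critical_disc_eq0.
have lin_u : T * (2 + u ^+ 3) ^+ 2 + A * u * T * (2 + u ^+ 3) + C * u ^+ 2 = 0.
  by have := lin 1; rewrite mulr1; apply.
have lin_u' : T * (2 + u' ^+ 3) ^+ 2 + A * u' * T * (2 + u' ^+ 3) + C * u' ^+ 2 = 0.
  by rewrite z1E; apply: lin; rewrite ?z10 // -z1E.
pose f := u * u'.
(* The factor to be cancelled in both eliminations below; D / u has constant term -4. *)
pose D := (2 + u ^+ 3) * u' - (2 + u' ^+ 3) * u.
have nzD : D != 0.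
  have -> : D = u * ((2 + u ^+ 3) * z1 - (2 + u' ^+ 3)).
    by rewrite /D {1}z1E; ring.
  apply: fps_mulf_neq0 => //; apply: fps_coef0_neq0.
  have c2 k : fps_coef (2 + (u * k) ^+ 3) 0 = 2.
    by rewrite fps_coefD fps_natr_coef0 exprS -mulrA fps_coefXM addr0.
  rewrite fps_coefD fps_coefN fps_coefM0 z10 z1E c2.
  by rewrite -[u in 2 + u ^+ 3]mulr1 c2.
have nzf : f != 0.
  by rewrite /f z1E !fps_mulf_neq0 // fps_coef0_neq0 // z10.
have nzTD : T * D != 0 by apply: fps_mulf_neq0.
have sqr_u : u ^+ 2 + u' ^+ 2 = 4 * f ^+ 4 - 2 * f.
  transitivity ((u + u') ^+ 2 - 2 * f); first by rewrite /f; ring.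
  by rewrite sum_u -/f; ring.
have cub_u : u ^+ 3 + u' ^+ 3 = 8 * f ^+ 6 - 6 * f ^+ 3.
  transitivity ((u + u') ^+ 3 - 3 * f * (u + u')); first by rewrite /f; ring.
  by rewrite sum_u -/f; ring.
have AE : A = - 2 * f - 4 * f ^+ 4.
  (* [C] is eliminated: u'^2 times [lin_u] minus u^2 times [lin_u'] is divisible by T D. *)
  have fAE : f * A = - (2 * (u + u') + f * (u ^+ 2 + u' ^+ 2)).
    apply: (fps_mulfI nzTD); rewrite -[RHS]addr0.
    rewrite -[X in _ + X](mulr0 (u' ^+ 2)) -[X in _ + u' ^+ 2 * X]lin_u.
    rewrite -[LHS]addr0 -[X in _ + X = _](mulr0 (u ^+ 2)).
    rewrite -[X in _ + u ^+ 2 * X = _]lin_u' /D /f.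
    by ring.
  apply: (fps_mulfI nzf); rewrite fAE sum_u sqr_u -/f; ring.
have fCE : f * C = T * (4 - 11 * f ^+ 3 + 16 * f ^+ 6).
  have -> : 4 - 11 * f ^+ 3 + 16 * f ^+ 6 = (2 + u ^+ 3) * (2 + u' ^+ 3).
    transitivity (4 + 2 * (8 * f ^+ 6 - 6 * f ^+ 3) + f ^+ 3); first by ring.
    by rewrite -cub_u /f; ring.
  (* [A] is eliminated: the multipliers are u' (2 + u'^3) for [lin_u] and u (2 + u^3) for
     [lin_u']. *)
  apply: (fps_mulfI nzD); rewrite -[LHS]addr0.
  rewrite -[X in _ + X = _](mulr0 (u' * (2 + u' ^+ 3))).
  rewrite -[X in _ + u' * _ * X = _]lin_u.
  rewrite -[RHS]addr0 -[X in _ = _ + X](mulr0 (u * (2 + u ^+ 3))).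
  by rewrite -[X in _ = _ + u * _ * X]lin_u' /D /f; ring.
have TE : f = 4 * T * f ^+ 3 - T.
  (* The sum of the two critical equations, written in f, is the claim times this factor, up to
     sign. *)
  have nz2 : 2 * (1 - 2 * f ^+ 3) != 0.
    apply: fps_coef0_neq0; rewrite fps_coefM0 fps_natr_coef0 fps_coefD fps_coefN.
    by rewrite fps_coefM0 {1}/f exprS -!mulrA fps_coefXM mulr0 subr0.
  apply: (fps_mulfI nz2).
  transitivity (- (u ^+ 2 + u' ^+ 2)); first by rewrite sqr_u; ring.
  rewrite crit_u crit_u'.
  transitivity (- T * (2 + 2 * (u ^+ 3 + u' ^+ 3))); first by ring.
  by rewrite cub_u; ring.
exists T1, (T * f); rewrite -/u -/T -/ev; split=> //.
- transitivity (T ^+ 2 * (4 * T * f ^+ 3 - T) + T ^+ 3); first by ring.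
  by rewrite -TE; ring.
- have nz2 : 2 != 0 :> fps rat by rewrite fps_coef0_neq0 ?fps_natr_coef0.
  apply: (fps_mulfI nz2); transitivity (T ^+ 4 * A); first by rewrite /A; ring.
  by rewrite AE; ring.
- apply: (fps_mulfI nzf); transitivity (T ^+ 4 * (f * C + 4 * f)).
    by rewrite /C; ring.
  rewrite fCE [X in 4 * X]TE; ring.
Qed.

(** * Integrality over polynomial rings, and algebraicity of Q *)

Section Integrality.
Variables (R K : comNzRingType) (f : {rmorphism R -> K}).
Implicit Types u v b c : K.

Lemma integral_exp u n : integralOver f u -> integralOver f (u ^+ n).
Proof.
move=> intu; elim: n => [|n IHn]; first exact: integral1.
by rewrite exprS; apply: integral_mul.
Qed.

Lemma integral_cubic u b c : integralOver f b -> integralOver f c ->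
  u ^+ 3 = b * u + c -> integralOver f u.
Proof.
move=> intb intc uE; pose q := b *: 'X + c%:P.
have szq : (size q < size ('X^3 : {poly K}))%N.
  rewrite size_polyXn (leq_ltn_trans (size_polyD _ _)) // gtn_max.
  rewrite (leq_ltn_trans (size_scale_leq _ _)) ?size_polyX //.
  by rewrite (leq_ltn_trans (size_polyC_leq1 _)).
apply: (@integral_root_monic _ _ f u ('X^3 - q)).
- by rewrite monicE lead_coefDl ?size_polyN // lead_coefXn.
- by rewrite /root !hornerE uE subrr.
apply/integral_poly => i; rewrite coefB coefXn coefD coefZ coefX coefC.
apply: integral_sub; first exact: integral_nat.
apply: integral_add; first by apply: integral_mul => //; apply: integral_nat.
by case: ifP => // _; apply: integral0.
Qed.

Lemma integral_sqrt u c : integralOver f c -> u ^+ 2 = c -> integralOver f u.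
Proof.
(* The square root is treated as a root of the cubic u^3 = c u + 0. *)
move=> intc uE; apply: (integral_cubic intc (integral0 f)).
by rewrite addr0 -uE -exprSr.
Qed.

(** Serves to pull integrality back along the substitution of u^2 / (1 + 2 u^3) for t. *)
Lemma integral_comp_inj (L : comNzRingType) (g : {rmorphism K -> L}) u :
  injective g -> integralOver (g \o f) (g u) -> integralOver f u.
Proof.
move=> inj_g [p mon_p]; rewrite map_poly_comp /root horner_map => root_u.
by exists p => //; rewrite /root -(inj_eq inj_g) rmorph0.
Qed.

End Integrality.

Lemma integral_fps_map (A B : comNzRingType) (k : {rmorphism A -> B}) z :
    integralOver (@fps_of_poly A) z ->
  integralOver (@fps_of_poly B) (fps_map k z).
Proof.
case=> p mon_p root_z; exists (map_poly (map_poly k) p); first exact: monic_map.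
rewrite -map_poly_comp (eq_map_poly (g := fps_map k \o @fps_of_poly A)) => [|q].
  by rewrite map_poly_comp rmorph_root.
by rewrite /= -fps_map_of_poly.
Qed.

(** If p annihilates d z, then p(d X) annihilates z, and it is nonzero because d is. *)
Lemma root_of_integral_multiple (R : idomainType) (K : comNzRingType)
    (f : {rmorphism R -> K}) d z :
    d != 0 -> integralOver f (f d * z) ->
  exists2 p : {poly R}, p != 0 & root (map_poly f p) z.
Proof.
move=> nz_d [p mon_p root_dz]; exists (p \Po (d *: 'X)).
  by rewrite comp_poly2_eq0 ?monic_neq0 // size_scale // size_polyX.
by rewrite map_comp_poly linearZ /= map_polyX /root horner_comp !hornerE.
Qed.

Ltac solve_integral := repeat first
  [ assumption | exact: integral_nat | exact: integral_id
  | apply: integral_sub | apply: integral_add | apply: integral_opp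
  | apply: integral_mul | apply: integral_exp ].

Lemma integral_var (A : comNzRingType) : integralOver (@fps_of_poly A) (fps_var A).
Proof. exact: integral_id. Qed.

Lemma integral_const (A : comNzRingType) b :
  integralOver (@fps_of_poly A) (fps_const b).
Proof. exact: integral_id. Qed.

(** After the substitution, [h] is integral by its cubic, and both series are polynomials in [T] and
    [h] with rational coefficients. *)
Lemma integral_origin_linear :
  integralOver (@fps_of_poly rat) (fps_var _ ^+ 4 * half_origin) /\
  integralOver (@fps_of_poly rat) (fps_var _ ^+ 4 * linear_coef).
Proof.
have [T1 [h [nzT1 hE aE cE]]] := critical_values.
pose ev : {rmorphism fps rat -> fps rat} := fps_eval (@fps_const rat) T1.
have inj_ev : injective ev := fps_eval_inj nzT1.
set T := fps_var _ * T1 in hE aE cE.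
have evT : ev (fps_var _) = T by exact: fps_eval_var.
pose g : {rmorphism {poly rat} -> fps rat} := ev \o @fps_of_poly rat.
have intT : integralOver g T by rewrite -evT; apply: integral_id.
have intC b : integralOver g (fps_const b).
  by rewrite -[fps_const b](fps_eval_const (@fps_const rat) T1); apply: integral_id.
have halfE (n : nat) (z w : fps rat) : n%:R != 0 :> rat ->
    n%:R * z = w -> z = fps_const n%:R^-1 * w.
  move=> nz_n <-; rewrite mulrA -(rmorph_nat (@fps_const rat)) -rmorphM.
  by rewrite mulVf // rmorph1 mul1r.
have int_h : integralOver g h.
  have hE' : h ^+ 3 = fps_const 4^-1 * T * h + fps_const 4^-1 * T ^+ 3.
    by rewrite (halfE 4%N _ _ _ hE) // mulrDr mulrA.
  by apply: integral_cubic hE'; solve_integral.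
split; apply: (integral_comp_inj inj_ev); rewrite rmorphM rmorphXn evT.
  rewrite (halfE 2%N (T ^+ 4 * ev half_origin) _ _ (etrans (mulrA _ _ _) aE)) //.
  by solve_integral.
rewrite (halfE 4%N (T ^+ 4 * ev linear_coef) _ _ (etrans (mulrA _ _ _) cE)) //.
by solve_integral.
Qed.

(** [root_of] is linear in [rho], and its square involves [a] and [c] linearly. Multiplying it by
    t^2 puts on the square the t^4 that makes [a] and [c] integral. *)
Lemma integral_axisGF :
  integralOver (@fps_of_poly {poly rat}) (2 * x * t ^+ 4 * rho).
Proof.
have [inta0 intc0] := integral_origin_linear.
have intt : integralOver (@fps_of_poly {poly rat}) t by apply: integral_var.
have intx : integralOver (@fps_of_poly {poly rat}) x by apply: integral_const.
have inta : integralOver (@fps_of_poly {poly rat}) (t ^+ 4 * a).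
  by rewrite -const_x_var -rmorphXn -rmorphM; apply: integral_fps_map.
have intc : integralOver (@fps_of_poly {poly rat}) (t ^+ 4 * c).
  by rewrite -const_x_var -rmorphXn -rmorphM; apply: integral_fps_map.
set ta := t ^+ 4 * a in inta; set tc := t ^+ 4 * c in intc.
pose w := t + x ^+ 2 - t * x ^+ 3.
pose d := t ^+ 4 * w ^+ 2 + 4%:R * ta * t * x * w + 4%:R * t * (tc - t ^+ 4) * x ^+ 2.
pose p := t ^+ 2 * root_of x t rho a.
have intw : integralOver (@fps_of_poly {poly rat}) w by rewrite /w; solve_integral.
have intp : integralOver (@fps_of_poly {poly rat}) p.
  apply: (integral_sqrt (c := d)); first by rewrite /d; solve_integral.
  rewrite /p exprMn root_sqr /disc_of /d /ta /tc /w.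
  by move: a c => b k; ring.
have -> : 2 * x * t ^+ 4 * rho =
    t * p - t ^+ 3 * (t - x ^+ 2 + t * x ^+ 3) + 2%:R * x * ta.
  by rewrite /p /ta /root_of; move: (axisGF) a => g b; ring.
by solve_integral.
Qed.

Lemma kernel_neq0 : kernel != 0.
Proof.
apply: fps_coef0_neq0; rewrite fps_coefD fps_coefN fps_coefXM subr0.
by rewrite fps_coefM0 !fps_coef_const mulf_neq0 // ?polyC_eq0 polyX_eq0.
Qed.

(** After multiplication by 2 x y t^4, every term on the right of the functional equation is
    integral; t R(0) is handled as 2 a. *)
Lemma integral_revKrewerasGF (d := 2 * x2 * y2 * t2 ^+ 4 * kernel) :
  integralOver (@fps_of_poly {poly {poly rat}}) (d * revKrewerasGF).
Proof.
have intR := integral_axisGF; have [inta0 _] := integral_origin_linear.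
have intt : integralOver (@fps_of_poly {poly {poly rat}}) t2.
  exact: integral_var.
have intx : integralOver (@fps_of_poly {poly {poly rat}}) x2.
  exact: integral_const.
have inty : integralOver (@fps_of_poly {poly {poly rat}}) y2.
  exact: integral_const.
pose a2 := axis_x a.
have intRx : integralOver (@fps_of_poly {poly {poly rat}})
    (2 * x2 * t2 ^+ 4 * (t2 * axis_x axisGF)).
  have <- : axis_x (2 * x * t ^+ 4 * rho) =
      2 * x2 * t2 ^+ 4 * (t2 * axis_x axisGF).
    by rewrite -axis_x_x -axis_x_var; ring.
  exact: (integral_fps_map polyC intR).
have intRy : integralOver (@fps_of_poly {poly {poly rat}})
    (2 * y2 * t2 ^+ 4 * (t2 * axis_y axisGF)).
  have <- : axis_y (2 * x * t ^+ 4 * rho) =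
      2 * y2 * t2 ^+ 4 * (t2 * axis_y axisGF).
    by rewrite -axis_y_x -axis_y_var; ring.
  exact: (integral_fps_map (map_poly polyC) intR).
have inta : integralOver (@fps_of_poly {poly {poly rat}}) (t2 ^+ 4 * a2).
  have <- : axis_x (const_x (fps_var _ ^+ 4 * half_origin)) = t2 ^+ 4 * a2.
    by rewrite rmorphM rmorphXn rmorphM rmorphXn /= const_x_var axis_x_var.
  exact: (integral_fps_map polyC (integral_fps_map polyC inta0)).
have a2E : t2 * axis_x (const_x originGF) = 2 * a2.
  by rewrite -axis_x_var -rmorphM -double_a rmorphM rmorph_nat.
have -> : d * revKrewerasGF = 2%:R * (x2 ^+ 2 * y2 ^+ 2 * t2 ^+ 4)
    - y2 * (2 * x2 * t2 ^+ 4 * (t2 * axis_x axisGF))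
    - x2 * (2 * y2 * t2 ^+ 4 * (t2 * axis_y axisGF))
    + 4%:R * x2 * y2 * (t2 ^+ 4 * a2).
  rewrite /d -mulrA functional_equation [t2 * axis_x (fps_map _ _)]a2E.
  by move: a2 (axis_x _) (axis_y _) {a2E inta intRx intRy} => *; ring.
by solve_integral.
Qed.

Theorem mainTheorem4 :
  exists2 P : {poly {poly {poly {poly rat}}}},
    P != 0 & root (map_poly (@fps_of_poly {poly {poly rat}}) P) revKrewerasGF.
Proof.
pose xy := (var_x * var_y)%:P : {poly {poly {poly rat}}}.
pose k := xy - 'X * (var_x ^+ 2 * var_y + var_x * var_y ^+ 2 + 1)%:P.
(* The multiplier of [integral_revKrewerasGF], as a polynomial in t; it is nonzero because its image
   is a product of nonzero series. *)
pose d := 2 * xy * 'X^4 * k.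
have dE : fps_of_poly d = 2 * x2 * y2 * t2 ^+ 4 * kernel.
  rewrite /d /k /xy /kernel /x_poly2 /y_poly2 /t_poly2 /fps_const /fps_var /=.
  by ring.
apply: (@root_of_integral_multiple _ _ _ d); last first.
  by have := integral_revKrewerasGF; rewrite -dE.
apply/eqP => d0; move/eqP: dE; rewrite d0 rmorph0 eq_sym; apply/negP.
have nz2 : 2 != 0 :> fps {poly {poly rat}}.
  rewrite fps_coef0_neq0 // fps_natr_coef0 -(rmorph_nat (polyC \o polyC)).
  by rewrite !polyC_eq0.
have nzx : x2 != 0.
  by rewrite fps_coef0_neq0 // fps_coef_const polyC_eq0 polyX_eq0.
have nzy : y2 != 0 by rewrite fps_coef0_neq0 // fps_coef_const polyX_eq0.
by rewrite !(fps_mulf_neq0, fps_expf_neq0) ?fps_var_neq0 ?kernel_neq0.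
Qed.
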